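(* Let $\mathscr H,\mathscr K$ be complex Hilbert spaces, let $0\le m<M<1$ be real numbers, and let $A_j\in\mathbb B(\mathscr H)$ $(1\le j\le n)$ be self-adjoint contractions with $mI_{\mathscr H}\le A_j\le MI_{\mathscr H}$. Let $\Phi_j:\mathbb B(\mathscr H)\to\mathbb B(\mathscr K)$ $(1\le j\le n)$ be unital positive linear maps, let $\omega_1,\dots,\omega_n$ be positive real numbers with $\sum_{j=1}^n\omega_j=1$, and let $0<p<1$. Put $$\delta=(1-p)\left(\frac1p\,\frac{(1-m)^p-(1-M)^p}{M-m}\right)^{\frac{p}{p-1}}+\frac{(1-M)(1-m)^p-(1-m)(1-M)^p}{M-m}.$$ Then $$\delta I_{\mathscr K}+\sum_{j=1}^n\omega_j\Phi_j\big((I_{\mathscr H}-A_j)^p\big)\ge\left(\sum_{j=1}^n\omega_j\Phi_j(I_{\mathscr H}-A_j)\right)^p.$$ In particular, for every unital positive linear map $\Phi:\mathbb B(\mathscr H)\to\mathbb B(\mathscr K)$, $$\delta I_{\mathscr K}+\Phi\left(\sum_{j=1}^n\omega_j(I_{\mathscr H}-A_j)^p\right)\ge\left(\Phi\Big(\sum_{j=1}^n\omega_j(I_{\mathscr H}-A_j)\Big)\right)^p.$$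
   Context: $\mathbb B(\mathscr H)$ is the algebra of bounded linear operators on $\mathscr H$, with identity $I_{\mathscr H}$. $A\ge 0$ means $\langle Ax,x\rangle\ge0$ for all $x$; $A\le B$ means $B-A\ge0$ for self-adjoint $A,B$. A contraction is an operator $A$ with $A^*A\le I_{\mathscr H}$. A linear map $\Phi:\mathbb B(\mathscr H)\to\mathbb B(\mathscr K)$ is positive if $A\ge0$ implies $\Phi(A)\ge0$, and unital if $\Phi(I_{\mathscr H})=I_{\mathscr K}$. Powers of positive operators are defined by functional calculus. *)

(* Defs.v *)
From HB Require Import structures.
From mathcomp Require Import all_boot all_order all_algebra.
From mathcomp Require Import complex.
From mathcomp Require Import all_classical all_reals all_analysis.

Set Implicit Arguments.
Unset Strict Implicit.
Unset Printing Implicit Defensive.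

Import Order.TTheory GRing.Theory Num.Theory.
Import numFieldNormedType.Exports.

Local Open Scope classical_set_scope.
Local Open Scope ring_scope.
Local Open Scope complex_scope.

(* Complex Hilbert spaces: complete normed spaces over R[i] whose norm comes
   from an inner product, linear in its first argument. *)
HB.mixin Record isHilbert (R : realType) H of CompleteNormedModule R[i] H := {
  inner : {dot H for @Num.conj R[i]};
  sqr_normE : forall x : H, `|x| ^+ 2 = inner x x
}.

#[short(type="hilbertType")]
HB.structure Definition Hilbert (R : realType) :=
  {H of isHilbert R H & CompleteNormedModule R[i] H}.

Notation "''[' x , y ]" := (inner x y)
  (at level 0, format "''[' x ,  y ]") : ring_scope.

Section BoundedOperators.
Context {R : realType} {H : hilbertType R}.

Definition bounded_linear : {pred H -> H} :=
  [pred f | `[< linear f /\ exists c : R[i], forall x, `|f x| <= c * `|x| >]].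

Lemma bounded_linearP (f : H -> H) :
  reflect (linear f /\ exists c : R[i], forall x, `|f x| <= c * `|x|)
          (f \in bounded_linear).
Proof. exact: asboolP. Qed.

Lemma bounded_linear_submod_closed : submod_closed bounded_linear.
Proof.
split=> [|a f g].
  apply/bounded_linearP; split=> [b x y|].
    by rewrite [LHS]/(0 : H) scaler0 addr0.
  by exists 0 => x; rewrite mul0r normr0.
move=> /bounded_linearP[lf [c fc]] /bounded_linearP[lg [d gd]].
apply/bounded_linearP; split.
  move=> b x y; rewrite -![(a *: f + g) _]/(a *: f _ + g _) lf lg.
  rewrite !scalerDr !scalerA (mulrC a b) -!addrA; congr (_ + _).
  by rewrite [LHS]addrCA.
exists (`|a| * c + d) => x; rewrite -[(a *: f + g) x]/(a *: f x + g x).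
rewrite (le_trans (ler_normD _ _))// mulrDl lerD// normrZ -mulrA.
by rewrite ler_wpM2l.
Qed.

HB.instance Definition _ := GRing.isSubmodClosed.Build R[i] (H -> H)
  bounded_linear bounded_linear_submod_closed.

Record bop : Type := Bop { bop_fun :> H -> H; _ : bop_fun \in bounded_linear }.

HB.instance Definition _ := [isSub for bop_fun].
HB.instance Definition _ := [Choice of bop by <:].
HB.instance Definition _ := [SubChoice_isSubLmodule of bop by <:].

Lemma bop_linear (A : bop) : linear A.
Proof. by case: A => f /= /bounded_linearP[]. Qed.

Lemma bop_bounded (A : bop) : exists c : R[i], forall x, `|A x| <= c * `|x|.
Proof. by case: A => f /= /bounded_linearP[]. Qed.

Lemma bop_id_subproof : idfun \in bounded_linear.
Proof.
apply/bounded_linearP; split=> //.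
by exists 1 => x; rewrite mul1r.
Qed.

Lemma bop_comp_subproof (A B : bop) : A \o B \in bounded_linear.
Proof.
apply/bounded_linearP; split=> [a x y /=|]; first by rewrite !bop_linear.
have [c Ac] := bop_bounded A; have [d Bd] := bop_bounded B.
exists (`|c| * d) => x /=; rewrite (le_trans (Ac _))//.
have [->|Bx0] := eqVneq (B x) 0.
  by rewrite normr0 mulr0 -mulrA mulr_ge0// (le_trans _ (Bd x)).
have cge0 : 0 <= c.
  by rewrite -(@pmulr_lge0 _ `|B x|) ?normr_gt0// (le_trans _ (Ac _)).
by rewrite ger0_norm// -mulrA ler_wpM2l.
Qed.

Definition bop_id : bop := Bop bop_id_subproof.
Definition bop_comp (A B : bop) : bop := Bop (bop_comp_subproof A B).

Lemma bopP (A B : bop) : (A : H -> H) =1 B -> A = B.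
Proof. by move=> AB; apply/val_inj/funext. Qed.

Lemma bop_compA : associative bop_comp.
Proof. by move=> A B C; exact: bopP. Qed.

Lemma bop_comp1l : left_id bop_id bop_comp.
Proof. by move=> A; exact: bopP. Qed.

Lemma bop_comp1r : right_id bop_id bop_comp.
Proof. by move=> A; exact: bopP. Qed.

Lemma bop_compDl : left_distributive bop_comp +%R.
Proof. by move=> A B C; exact: bopP. Qed.

Lemma bop_compDr : right_distributive bop_comp +%R.
Proof.
move=> A B C; apply: bopP => x.
by rewrite /= -[LHS]/(A (B x + C x)) -[B x]scale1r bop_linear !scale1r.
Qed.

(* 1 is the identity operator and A * B is the composition x |-> A (B x). *)
HB.instance Definition _ := GRing.Zmodule_isPzRing.Build bop
  bop_compA bop_comp1l bop_comp1r bop_compDl bop_compDr.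

End BoundedOperators.

Arguments bop {R} H.

Notation "\Id_ H" := (1 : bop H)
  (at level 8, H at level 2, format "\Id_ H") : ring_scope.

Section OperatorNotions.
Context {R : realType} {H : hilbertType R}.
Implicit Types A B : bop H.

Definition opnorm A : R :=
  sup [set complex.Re `|A x| | x in [set x : H | `|x| <= 1]].

Definition adjoint A : bop H :=
  xget 0 [set B : bop H | forall x y, '[A x, y] = '[x, B y]].

Definition selfadjoint A := adjoint A = A.

(* 0 <= z in R[i] means that z is real and nonnegative. *)
Definition op_ge0 A := forall x : H, 0 <= '[A x, x].

Definition op_le A B := op_ge0 (B - A).

Definition op_contraction A := op_le (adjoint A * A) \Id_H.

Definition op_invertible A := exists B, B * A = \Id_H /\ A * B = \Id_H.

Definition spectrum A : set R[i] :=
  [set z | ~ op_invertible (z *: \Id_H - A)].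

Definition real_spectrum A : set R := [set t | spectrum A t%:C].

Definition op_horner (P : {poly R}) A : bop H :=
  \sum_(k < size P) (P`_k)%:C *: A ^+ k.

(* Continuous functional calculus of a self-adjoint operator (whose spectrum is
   real): f(A) is the norm limit of P_k(A) for real polynomials P_k converging
   to f uniformly on the spectrum of A (default 0 when there is no such limit). *)
Definition fcalc (f : R -> R) A : bop H :=
  xget 0 [set B : bop H | exists P : nat -> {poly R},
    {uniform real_spectrum A, (fun k t => (P k).[t]) @ \oo --> f} /\
    opnorm (op_horner (P k) A - B) @[k --> \oo] --> (0 : R)].

Definition op_powR A (p : R) : bop H := fcalc (fun t => t `^ p) A.

End OperatorNotions.

Section Maps.
Context {R : realType} {H K : hilbertType R}.

Definition positive_map (Phi : bop H -> bop K) :=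
  forall A, op_ge0 A -> op_ge0 (Phi A).

Definition unital_map (Phi : bop H -> bop K) := Phi \Id_H = \Id_K.

End Maps.

Definition delta {R : realType} (m M p : R) : R :=
  (1 - p) *
    (p^-1 * (((1 - m) `^ p - (1 - M) `^ p) / (M - m))) `^ (p / (p - 1)) +
  ((1 - M) * (1 - m) `^ p - (1 - m) * (1 - M) `^ p) / (M - m).

(* Main.v *)
(* Put X = I - A_j, a = 1 - M, b = 1 - m. On [a, b] the concave function t^p lies
   above its chord al t + be, and everywhere t^p <= al t + be + delta, because
   delta + be is the maximum of t^p - al t. Positivity and unitality of the Phi_j
   turn the first inequality into one for sum_j w_j Phi_j(X_j^p), and the second
   one is applied to the operator S = sum_j w_j Phi_j(X_j), whose spectrum is again
   in [a, b].

   The functional calculus preserves these bounds because P(T) >= 0 for every real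
   polynomial P that is nonnegative on the spectrum of a symmetric operator T: the
   largest l with l <= P(T) belongs to the spectrum of P(T), hence l = P(t) with t
   in the spectrum of T by factoring P - l over the complex numbers. It is defined
   at t^p thanks to Bernstein polynomials, whose error at t^p is controlled by the
   elementary bounds 1 + p v - (1 - p) v^2 <= (1 + v)^p <= 1 + p v. *)

Require Import Defs.
From mathcomp Require Import all_boot all_order all_algebra.
From mathcomp Require Import complex.
From mathcomp Require Import all_classical all_reals all_analysis.
From mathcomp Require Import ring lra.

Set Implicit Arguments.
Unset Strict Implicit.
Unset Printing Implicit Defensive.

Import Order.TTheory GRing.Theory Num.Theory.
Import numFieldNormedType.Exports.

Local Open Scope ring_scope.
Local Open Scope complex_scope.

(** * Hilbert spaces and operator order *)

Section InnerProduct.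
Context {R : realType} {H : hilbertType R}.
Implicit Types (x y z : H) (a : R[i]).

Lemma innerDl x y z : '[x + y, z] = '[x, z] + '[y, z].
Proof. exact: linearDl. Qed.

Lemma innerDr x y z : '[z, x + y] = '[z, x] + '[z, y].
Proof. exact: linearDr. Qed.

Lemma innerBl x y z : '[x - y, z] = '[x, z] - '[y, z].
Proof. exact: linearBl. Qed.

Lemma innerBr x y z : '[z, x - y] = '[z, x] - '[z, y].
Proof. exact: linearBr. Qed.

Lemma innerZl a x y : '[a *: x, y] = a * '[x, y].
Proof. exact: linearZl_LR. Qed.

Lemma innerZr a x y : '[x, a *: y] = a^*%R * '[x, y].
Proof. exact: linearZr_LR. Qed.

Lemma innerC x y : '[x, y] = ('[y, x])^*%R.
Proof. by rewrite (hermC (inner : {dot H for _})) /= expr0 mul1r. Qed.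

Lemma conj_real (c : R) : (c%:C)^*%R = c%:C.
Proof. by apply/CrealP; rewrite complex_real. Qed.

Lemma innerZr_real (c : R) x y : '[x, c%:C *: y] = c%:C * '[x, y].
Proof. by rewrite innerZr conj_real. Qed.

Lemma inner0l x : '[0, x] = 0.
Proof. exact: linear0l. Qed.

Lemma inner0r x : '[x, 0] = 0.
Proof. exact: linear0r. Qed.

(** Expand the squared norm of |y|^2 x - <x, y> y, which is nonnegative, and cancel |y|^2. *)
Lemma cauchy_schwarz x y : `|'[x, y]| <= `|x| * `|y|.
Proof.
have [->|y0] := eqVneq y 0.
  by rewrite linear0r normr0 normr0 mulr0.
have ny : 0 < `|y| by rewrite normr_gt0.
rewrite -(@ler_pXn2r _ 2) ?nnegrE ?mulr_ge0// exprMn.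
have := exprn_ge0 2 (normr_ge0 (`|y| ^+ 2 *: x - '[x, y] *: y)).
rewrite sqr_normE innerBl !innerBr !innerZl !innerZr -!sqr_normE.
rewrite [(`|y| ^+ 2)^*%R]geC0_conj ?exprn_ge0//.
rewrite (normCK (inner x y)) (innerC y x).
set d := '[x, y]; set n := `|y| ^+ 2; set m := `|x| ^+ 2; set e := d^*%R.
have -> : n * (n * m) - n * (e * d) - (d * (n * e) - d * (e * n)) =
  n * (m * n - d * e) by ring.
by rewrite pmulr_rge0 ?exprn_gt0// subr_ge0.
Qed.

End InnerProduct.

Section Operators.
Context {R : realType} {H : hilbertType R}.
Implicit Types (x y z : H) (A B S T : bop H).

Lemma bopD A B x : (A + B) x = A x + B x. Proof. by []. Qed.
Lemma bopN A x : (- A) x = - A x. Proof. by []. Qed.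
Lemma bopB A B x : (A - B) x = A x - B x. Proof. by []. Qed.
Lemma bopZ a A x : (a *: A) x = a *: A x. Proof. by []. Qed.
Lemma bop1 x : \Id_H x = x. Proof. by []. Qed.
Lemma bop0 x : (0 : bop H) x = 0. Proof. by []. Qed.
Lemma bopM A B x : (A * B) x = A (B x). Proof. by []. Qed.
Definition bopE := (bopD, bopN, bopZ, bop1, bop0, bopM).

Lemma bop_at0 A : A 0 = 0.
Proof. by have := bop_linear A (-1) 0 0; rewrite scaler0 addr0 scaleN1r addNr. Qed.

Lemma bop_atD A x y : A (x + y) = A x + A y.
Proof. by have := bop_linear A 1 x y; rewrite !scale1r. Qed.

Lemma bop_atZ A a x : A (a *: x) = a *: A x.
Proof. by have := bop_linear A a x 0; rewrite bop_at0 !addr0. Qed.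

Lemma bop_atB A x y : A (x - y) = A x - A y.
Proof. by rewrite -scaleN1r bop_atD bop_atZ scaleN1r. Qed.

Lemma bop_scalerAl a A B : a *: (A * B) = (a *: A) * B.
Proof. exact: bopP. Qed.

Lemma bop_scalerAr a A B : a *: (A * B) = A * (a *: B).
Proof. by apply: bopP => x; rewrite !bopE bop_atZ. Qed.

(** Formal symmetry avoids the choice made in [adjoint]; over complex scalars it follows from
    positivity. *)
Definition op_symmetric T := forall x y, '[T x, y] = '[x, T y].

(* Polarization at x + y and x + i y. *)
Lemma op_ge0_symmetric T : op_ge0 T -> op_symmetric T.
Proof.
move=> T0.
(* [b] measures the failure of symmetry; it is sesquilinear and vanishes on the diagonal. *)
pose b x y := '[T x, y] - '[x, T y].
have b0 x : b x x = 0.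
  rewrite /b (innerC x (T x)) geC0_conj ?subrr//; exact: T0.
have bD x y u v : b (x + y) (u + v) = b x u + b x v + b y u + b y v.
  by rewrite /b !bop_atD !innerDl !innerDr; ring.
have bZ a c x y : b (a *: x) (c *: y) = a * c^*%R * b x y.
  by rewrite /b !bop_atZ !innerZl !innerZr; ring.
move=> x y.
have e1 : b x y + b y x = 0.
  by have := b0 (x + y); rewrite bD !b0 addr0 add0r.
have e2 : b x y - b y x = 0.
  have := b0 (1 *: x + 'i%R *: y); rewrite bD !bZ !b0 !mulr0 addr0 add0r.
  rewrite conjCi rmorph1.
  have -> : 1 * - 'i%R * b x y + 'i%R * 1 * b y x = - 'i%R * (b x y - b y x).
    by ring.
  by move/eqP; rewrite mulf_eq0 oppr_eq0 (negbTE (neq0Ci _)) => /eqP.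
have : b x y *+ 2 = 0 by rewrite mulr2n -{2}[b x y](subrK (b y x)) e2 add0r e1.
by move/eqP; rewrite mulrn_eq0 /= subr_eq0 => /eqP.
Qed.

Lemma op_ge0D S T : op_ge0 S -> op_ge0 T -> op_ge0 (S + T).
Proof. by move=> S0 T0 x; rewrite bopE innerDl addr_ge0. Qed.

Lemma op_ge0Z (c : R) T : 0 <= c -> op_ge0 T -> op_ge0 (c%:C *: T).
Proof. by move=> c0 T0 x; rewrite bopE innerZl mulr_ge0// ler0c. Qed.

Lemma op_ge0_1 : op_ge0 \Id_H.
Proof. by move=> x; rewrite bopE -sqr_normE exprn_ge0. Qed.

Lemma op_ge0_sum n (F : 'I_n -> bop H) :
  (forall i, op_ge0 (F i)) -> op_ge0 (\sum_i F i).
Proof.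
move=> F0; elim/big_ind : _ => //; last exact: op_ge0D.
by move=> x; rewrite bopE inner0l.
Qed.

Lemma op_le_trans A B S : op_le A B -> op_le B S -> op_le A S.
Proof.
move=> AB BS; rewrite /op_le -[S](subrK B) -addrA; exact: op_ge0D.
Qed.

Lemma op_leD A B S T : op_le A B -> op_le S T -> op_le (A + S) (B + T).
Proof. by move=> AB ST; rewrite /op_le opprD addrACA; exact: op_ge0D. Qed.

Lemma op_leZ (c : R) A B : 0 <= c -> op_le A B -> op_le (c%:C *: A) (c%:C *: B).
Proof. by move=> c0 AB; rewrite /op_le -scalerBr; exact: op_ge0Z. Qed.

Lemma op_le_sum n (F G : 'I_n -> bop H) :
  (forall i, op_le (F i) (G i)) -> op_le (\sum_i F i) (\sum_i G i).
Proof. by move=> FG; rewrite /op_le -sumrB; exact: op_ge0_sum. Qed.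

Lemma op_le_scal (c d : R) : c <= d -> op_le (c%:C *: \Id_H) (d%:C *: \Id_H).
Proof.
move=> cd; rewrite /op_le -scalerBl -rmorphB.
by apply: op_ge0Z op_ge0_1; rewrite subr_ge0.
Qed.

Lemma symmetric_real T (x : H) : op_symmetric T -> '[T x, x] \is Num.real.
Proof. by move=> sT; apply/CrealP; rewrite -innerC sT. Qed.

Lemma symmetric1 : op_symmetric \Id_H. Proof. by []. Qed.

Lemma symmetric0 : op_symmetric (0 : bop H).
Proof. by move=> x y; rewrite !bopE inner0l inner0r. Qed.

Lemma symmetricD S T : op_symmetric S -> op_symmetric T -> op_symmetric (S + T).
Proof. by move=> sS sT x y; rewrite !bopE innerDl innerDr sS sT. Qed.

Lemma symmetricZ (c : R) T : op_symmetric T -> op_symmetric (c%:C *: T).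
Proof. by move=> sT x y; rewrite !bopE innerZl innerZr_real sT. Qed.

Lemma symmetricX T n : op_symmetric T -> op_symmetric (T ^+ n).
Proof.
move=> sT; elim: n => [|n IH]; first exact: symmetric1.
by move=> x y; rewrite {1}exprS exprSr !bopE sT IH.
Qed.

(** T - c is nonnegative, hence symmetric, and so is a real multiple of the identity. *)
Lemma op_le_symmetric (c : R) T : op_le (c%:C *: \Id_H) T -> op_symmetric T.
Proof.
move=> /op_ge0_symmetric sT; rewrite -[T](subrK (c%:C *: \Id_H)).
by apply: symmetricD sT _; apply: symmetricZ symmetric1.
Qed.

(* Expand the nonnegative number <T (T x - c x), T x - c x>. *)
Lemma op_ge0_sqr_norm T (c : R) : 0 < c -> op_ge0 T -> op_le T (c%:C *: \Id_H) ->
  forall x, `|T x| ^+ 2 <= c%:C * '[T x, x].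
Proof.
move=> c0 T0 Tc x.
have sT := op_ge0_symmetric T0.
have := T0 (T x - c%:C *: x); have := Tc (T x).
rewrite bopB !bopE innerBl innerZl bop_atB bop_atZ !innerBl !innerBr !innerZl.
rewrite !innerZr_real.
rewrite (sT (T x) x) -!sqr_normE.
have cC : 0 < c%:C :> R[i] by rewrite ltcR.
move: cC; set n := `|T x| ^+ 2; set d := c%:C; set u := '[T (T x), T x].
set v := '[T x, x] => d0 h1 h2.
rewrite -subr_ge0 -(pmulr_rge0 _ d0).
have -> : d * (d * v - n) = (d * n - u) + (u - d * n - (d * n - d * (d * v))) by ring.
exact: addr_ge0.
Qed.

(** A bound on the norm, easier to add and multiply than the supremum in [opnorm]. *)
Definition op_bounded T (c : R) := forall x, `|T x| <= c%:C * `|x|.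

Lemma ler_rM (c d : R) x : c <= d -> c%:C * `|x| <= d%:C * `|x|.
Proof. by move=> cd; rewrite ler_wpM2r// lecR. Qed.

Lemma op_bounded_ge T (c d : R) : c <= d -> op_bounded T c -> op_bounded T d.
Proof. by move=> cd Tc x; exact: le_trans (Tc x) (ler_rM _ cd). Qed.

(** The constant given by [bop_bounded] is complex: it is real and nonnegative once some vector is
    nonzero, and on the zero space any constant serves. Adding 1 makes it positive. *)
Lemma op_bounded_ex T : exists2 c : R, 0 < c & op_bounded T c.
Proof.
have [c Tc] := bop_bounded T; exists (complex.Re `|c| + 1).
  rewrite ltr_wpDl// -ler0c.
  by have /complex_realP[r r'] := normr_real c; rewrite r' /= -r'.
have [x0|x0] := pselect (exists x : H, x != 0); last first.
  move=> x; have -> : x = 0 by apply: contrapT => /eqP ?; apply: x0; exists x.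
  by rewrite bop_at0 normr0 mulr0.
have c0 : 0 <= c.
  have [x x0'] := x0; have := le_trans (normr_ge0 _) (Tc x).
  by rewrite pmulr_lge0// normr_gt0.
move=> x; apply: le_trans (Tc x) _; rewrite ler_wpM2r// ger0_norm//.
move: c0; rewrite lecE => /andP[/eqP /= ci _].
by rewrite lecE /= ci eqxx /= lerDl ler01.
Qed.

(** By Cauchy-Schwarz |<T x, x>| <= c |x|^2, and <T x, x> is real by symmetry. *)
Lemma op_bounded_scal T (c : R) : 0 <= c -> op_bounded T c -> op_symmetric T ->
  op_le T (c%:C *: \Id_H) /\ op_le ((- c)%:C *: \Id_H) T.
Proof.
move=> c0 Tc sT.
have key x : `|'[T x, x]| <= c%:C * '[x, x].
  rewrite -sqr_normE expr2 mulrA (le_trans (cauchy_schwarz _ _))//.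
  by rewrite ler_wpM2r// ltW.
split=> x; move: (key x); rewrite real_ler_norml ?symmetric_real// => /andP[h1 h2].
  by rewrite bopB !bopE innerBl innerZl subr_ge0.
by rewrite bopB !bopE innerBl innerZl subr_ge0 rmorphN mulNr.
Qed.

(** Chain |T x|^2 <= c <T x, x> with <T x, x> <= c |x|^2. *)
Lemma op_ge0_bounded T (c : R) : 0 < c -> op_ge0 T -> op_le T (c%:C *: \Id_H) ->
  op_bounded T c.
Proof.
move=> c0 T0 Tc x.
have cC : 0 < c%:C :> R[i] by rewrite ltcR.
rewrite -(@ler_pXn2r _ 2) ?nnegrE ?mulr_ge0 ?(ltW cC)// exprMn.
apply: le_trans (op_ge0_sqr_norm c0 T0 Tc x) _.
rewrite [c%:C ^+ 2]expr2 -mulrA ler_pM2l// sqr_normE.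
by have := Tc x; rewrite bopB !bopE innerBl innerZl subr_ge0.
Qed.

(** T + c lies between 0 and 2c, so its norm is at most 2c; removing c costs another c. This crude
    constant suffices for convergence. *)
Lemma symmetric_bounded T (c : R) : 0 < c -> op_le T (c%:C *: \Id_H) ->
  op_le ((- c)%:C *: \Id_H) T -> op_bounded T (3 * c).
Proof.
move=> c0 h1 h2 x.
have P0 : op_ge0 (T + c%:C *: \Id_H).
  by have := h2; rewrite /op_le rmorphN scaleNr opprK.
have P2 : op_le (T + c%:C *: \Id_H) ((c + c)%:C *: \Id_H).
  by rewrite rmorphD scalerDl; apply: op_leD h1 _; exact: op_le_scal.
have := op_ge0_bounded (addr_gt0 c0 c0) P0 P2 x.
move=> h.
have -> : T x = (T + c%:C *: \Id_H) x - c%:C *: x by rewrite !bopE addrK.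
apply: le_trans (ler_normB _ _) _.
have -> : (3 * c)%:C = (c + c)%:C + c%:C :> R[i].
  by rewrite -rmorphD; congr (_%:C); ring.
rewrite mulrDl lerD// normrZ ger0_norm// ler0c; exact: ltW.
Qed.

Lemma op_boundedD S T (c d : R) : op_bounded S c -> op_bounded T d ->
  op_bounded (S + T) (c + d).
Proof.
move=> Sc Td x; rewrite bopE rmorphD mulrDl; apply: le_trans (ler_normD _ _) _.
exact: lerD.
Qed.

Lemma op_boundedN T (c : R) : op_bounded T c -> op_bounded (- T) c.
Proof. by move=> Tc x; rewrite bopE normrN. Qed.

Lemma op_boundedM S T (c d : R) : 0 <= c -> op_bounded S c -> op_bounded T d ->
  op_bounded (S * T) (c * d).
Proof.
move=> c0 Sc Td x; rewrite bopE rmorphM -mulrA; apply: le_trans (Sc _) _.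
by rewrite ler_wpM2l// ler0c.
Qed.

Lemma op_bounded_eq0 T : (forall e : R, 0 < e -> op_bounded T e) -> T = 0.
Proof.
move=> T0; apply: bopP => x; rewrite bop0.
have [->|x0] := eqVneq x 0; first exact: bop_at0.
apply/eqP; rewrite -normr_eq0; apply/eqP.
have nx : 0 < `|x| by rewrite normr_gt0.
have : forall z : H, `|z| = (complex.Re `|z|)%:C.
  by move=> z; rewrite RRe_real.
move=> nE; move: nx; rewrite (nE x) (nE (T x)) ltcR => nx.
congr (_%:C); apply/eqP; rewrite eq_le; apply/andP; split; last first.
  by rewrite -ler0c -nE.
apply/ler_addgt0Pl => e e0; rewrite addr0.
have := T0 (e / complex.Re `|x|) (divr_gt0 e0 nx) x.
by rewrite (nE x) (nE (T x)) -rmorphM lecR mulfVK// gt_eqF.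
Qed.

(** Each <T x, x> is a limit of nonnegative reals <S x, x>, hence is one itself. This closedness
    carries inequalities from polynomials over to [fcalc]. *)
Lemma op_ge0_closed T :
  (forall e : R, 0 < e -> exists2 S, op_ge0 S & op_bounded (T - S) e) -> op_ge0 T.
Proof.
move=> TS x.
have key (e : R) : 0 < e -> exists2 w : R[i], 0 <= w &
    `|'[T x, x] - w| <= e%:C * `|x| ^+ 2.
  move=> e0; have [S S0 TSe] := TS _ e0; exists '[S x, x]; first exact: S0.
  rewrite -innerBl (le_trans (cauchy_schwarz _ _))// expr2 mulrA ler_wpM2r//.
  exact: TSe.
have [x0|x0] := eqVneq x 0; first by rewrite x0 inner0r.
have [r rE] : exists r : R, `|x| ^+ 2 = r%:C.
  by apply/complex_realP; rewrite ger0_real.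
have r0 : 0 < r by rewrite -ltcR -rE exprn_gt0// normr_gt0.
have {}key (e : R) : 0 < e -> exists2 w : R[i], 0 <= w & `|'[T x, x] - w| <= e%:C.
  move=> e0; have [w w0 hw] := key _ (divr_gt0 e0 r0); exists w => //.
  by move: hw; rewrite rE -rmorphM mulfVK// gt_eqF.
rewrite lecE /=; apply/andP; split.
  rewrite -normr_le0; apply/ler_addgt0Pl => e e0; rewrite addr0.
  have [w w0 hw] := key _ e0.
  (* Multiplication by i turns the imaginary part, up to sign, into a real part. *)
  have := le_trans (normc_ge_Re (('[T x, x] - w) * 'i%C)) (_ : _ <= e%:C).
  rewrite normrM [`|'i%C|]normc_def /= expr0n expr1n add0r sqrtr1 mulr1.
  move=> /(_ hw); rewrite lecR ReiNIm normrN raddfB /=.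
  by rewrite (ger0_Im w0) subr0.
apply/ler_addgt0Pl => e e0.
have [w w0 hw] := key _ e0.
have := le_trans (normc_ge_Re ('[T x, x] - w)) hw.
rewrite lecR raddfB /= ler_norml => /andP[+ _].
move: w0; rewrite lecE => /andP[_ /= w0]; lra.
Qed.

End Operators.

(** * Completeness and spectra of self-adjoint operators *)

Section Spectrum.
Context {R : realType} {H : hilbertType R}.
Implicit Types (x y z : H) (A B S T : bop H).

Lemma gt0_realC (e : R[i]) : 0 < e -> exists2 r : R, 0 < r & e = r%:C.
Proof.
move=> e0; have /complex_realP[r er] := gtr0_real e0.
by exists r => //; rewrite -ltcR -er.
Qed.

(** Completeness in e-N form, with real e in place of filters and complex radii. *)
Lemma hilbert_cauchy_cvg (u : nat -> H) :
  (forall e : R, 0 < e -> exists N, forall m n, (N <= m)%N -> (N <= n)%N ->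
    `|u m - u n| <= e%:C) ->
  exists l, forall e : R, 0 < e -> exists N, forall n, (N <= n)%N ->
    `|u n - l| <= e%:C.
Proof.
move=> uC.
have : cauchy (u @ \oo)%classic.
  apply/cauchyP => e /gt0_realC[r r0 ->].
  have [N uN] := uC _ (divr_gt0 r0 (ltr0n R 2)).
  exists (u N); exists N => // n /= Nn.
  rewrite -ball_normE /=; apply: le_lt_trans (uN _ _ (leqnn N) Nn) _.
  by rewrite ltcR; lra.
move=> /cauchy_cvgP /cvg_ex[l /= ul]; exists l => e e0.
move/cvgrPdist_le : ul => /(_ e%:C); rewrite ltcR => /(_ e0)[N _ uN].
by exists N => n Nn; rewrite distrC; exact: uN.
Qed.

Lemma op_bounded_atB (u : nat -> bop H) m n c x : op_bounded (u m - u n) c ->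
  `|u m x - u n x| <= c%:C * `|x|.
Proof. by move=> /(_ x); rewrite bopB. Qed.

(** The limit is built pointwise; linearity passes to the limit, and the Cauchy estimate makes the
    convergence uniform on bounded sets. *)
Lemma op_cauchy_cvg (u : nat -> bop H) :
  (forall e : R, 0 < e -> exists N, forall m n, (N <= m)%N -> (N <= n)%N ->
    op_bounded (u m - u n) e) ->
  exists l, forall e : R, 0 < e -> exists N, forall n, (N <= n)%N ->
    op_bounded (u n - l) e.
Proof.
move=> uC.
have ptC x : exists l, forall e : R, 0 < e -> exists N, forall n, (N <= n)%N ->
    `|u n x - l| <= e%:C.
  apply: hilbert_cauchy_cvg => e e0.
  have [r r0 xr] : exists2 r : R, 0 < r & `|x| <= r%:C.
    have /complex_realP[r xr] := normr_real x; exists (r + 1).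
      by rewrite ltr_wpDl// -ler0c -xr.
    by rewrite xr lecR lerDl.
  have [N uN] := uC _ (divr_gt0 e0 r0); exists N => m n Nm Nn.
  apply: le_trans (op_bounded_atB x (uN m n Nm Nn)) _.
  apply: (@le_trans _ _ ((e / r)%:C * r%:C)).
    by rewrite ler_wpM2l// ler0c divr_ge0// ltW.
  by rewrite -rmorphM divfK// gt_eqF.
have [l ul] := choice ptC.
have lin : linear l.
  move=> a x y; apply/eqP; rewrite -subr_eq0 -normr_le0.
  suff h (e : R) : 0 < e -> `|l (a *: x + y) - (a *: l x + l y)| <= e%:C.
    have /complex_realP[r rE] := normr_real (l (a *: x + y) - (a *: l x + l y)).
    rewrite rE -(rmorph0 (real_complex R)) lecR; apply/ler_addgt0Pl => e e0.
    by rewrite addr0 -lecR -rE; exact: h.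
  move=> e0.
  have [s s0 as_] : exists2 s : R, 0 < s & `|a| <= s%:C.
    have /complex_realP[s as_] := normr_real a; exists (s + 1).
      by rewrite ltr_wpDl// -ler0c -as_.
    by rewrite as_ lecR lerDl.
  have e3 : 0 < e / 3 by rewrite divr_gt0.
  have [N1 h1] := ul (a *: x + y) _ e3.
  have [N2 h2] := ul x _ (divr_gt0 e3 s0).
  have [N3 h3] := ul y _ e3.
  pose n := maxn N1 (maxn N2 N3).
  have {}h1 := h1 n (leq_maxl _ _).
  have {}h2 : `|u n x - l x| <= _ := h2 n (leq_trans (leq_maxl _ _) (leq_maxr _ _)).
  have {}h3 : `|u n y - l y| <= _ := h3 n (leq_trans (leq_maxr _ _) (leq_maxr _ _)).
  have -> : l (a *: x + y) - (a *: l x + l y) =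
      a *: (u n x - l x) + (u n y - l y) - (u n (a *: x + y) - l (a *: x + y)).
    by rewrite bop_atD bop_atZ scalerBr addrACA -opprD opprB [RHS]addrC subrKA.
  apply: le_trans (ler_normB _ _) _.
  have -> : e%:C = (e / 3)%:C + (e / 3)%:C + (e / 3)%:C :> R[i].
    by rewrite -!rmorphD; congr (_%:C); field.
  apply: lerD => //; apply: le_trans (ler_normD _ _) _; apply: lerD => //.
  rewrite normrZ; apply: (@le_trans _ _ (s%:C * (e / 3 / s)%:C)).
    by apply: ler_pM => //; exact: normr_ge0.
  by rewrite -rmorphM mulrC divfK// gt_eqF.
(* N comes from the Cauchy condition alone; only the auxiliary index m, which makes u_m x close to l
   x, depends on x. *)
have unif (e : R) : 0 < e -> exists N, forall n, (N <= n)%N ->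
    forall x, `|u n x - l x| <= e%:C * `|x|.
  move=> e0; have [N uN] := uC _ e0; exists N => n Nn x.
  have /complex_realP[r rE] := normr_real (u n x - l x).
  have /complex_realP[s sE] := normr_real x.
  rewrite rE sE -rmorphM lecR; apply/ler_addgt0Pl => d d0.
  have [N' h'] := ul x _ d0.
  pose m := maxn N N'.
  have h1 := op_bounded_atB x (uN n m Nn (leq_maxl _ _)).
  have h2 := h' m (leq_maxr _ _).
  rewrite -lecR rmorphD rmorphM /= -rE -sE.
  rewrite -(subrKA (u m x)) (le_trans (ler_normD _ _))// addrC.
  exact: lerD.
have bl : l \in bounded_linear.
  apply/bounded_linearP; split=> //.
  (* The limit is within distance 1 of some u_N, hence bounded. *)
  have [N uN] := unif 1 ltr01.
  have [c _ uc] := op_bounded_ex (u N).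
  exists (1%:C + c%:C) => x; rewrite mulrDl.
  rewrite -[l x](subrK (u N x)) (le_trans (ler_normD _ _))// lerD//.
  by rewrite distrC uN.
exists (Bop bl) => e e0; have [N uN] := unif _ e0; exists N => n Nn x.
by rewrite bopB; exact: uN.
Qed.

Lemma geometric_small (r e : R) : 0 <= r -> r < 1 -> 0 < e ->
  exists N, forall n, (N <= n)%N -> r ^+ n <= e.
Proof.
move=> r0 r1 e0.
have : `|r| < 1 by rewrite ger0_norm.
move/cvg_expr => /cvgrPdist_le /(_ _ e0)[N _ rN]; exists N => n Nn.
by have := rN n Nn; rewrite sub0r normrN ger0_norm// exprn_ge0.
Qed.

(** Neumann series: the partial sums of the powers of T converge in norm, and their products with 1
    - T telescope. *)
Lemma op_bounded_invertible T (r : R) : 0 < r -> r < 1 -> op_bounded T r ->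
  op_invertible (\Id_H - T).
Proof.
move=> r0 r1 Tr.
pose u n := \sum_(k < n) T ^+ k.
have Tn n : op_bounded (T ^+ n) (r ^+ n).
  elim: n => [|n IH]; first by move=> x; rewrite !expr0 rmorph1 mul1r.
  by rewrite !exprS; apply: op_boundedM IH => //; exact: ltW.
have r1' : 0 < 1 - r by rewrite subr_gt0.
(* The bound is the geometric sum r^n + ... + r^(n+j-1). *)
have uD n j : op_bounded (u (n + j)%N - u n) ((r ^+ n - r ^+ (n + j)) / (1 - r)).
  elim: j => [|j IH].
    by move=> x; rewrite addn0 !subrr mul0r normr0 rmorph0 mul0r.
  rewrite addnS {1}/u big_ord_recr /= -/(u _) addrAC.
  apply: op_bounded_ge (op_boundedD IH (Tn _)).
  rewrite exprS le_eqVlt; apply/orP; left; apply/eqP; field.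
  by rewrite gt_eqF.
have [G uG] : exists l, forall e : R, 0 < e -> exists N, forall n, (N <= n)%N ->
    op_bounded (u n - l) e.
  apply: op_cauchy_cvg => e e0.
  have [N rN] := geometric_small (ltW r0) r1 (mulr_gt0 e0 r1').
  exists N => m n.
  have key a b : (N <= a)%N -> (a <= b)%N -> op_bounded (u b - u a) e.
    move=> Na ab; rewrite -(subnKC ab); apply: op_bounded_ge (uD _ _).
    rewrite ler_pdivrMr//; apply: le_trans (rN _ Na).
    by rewrite gerBl exprn_ge0// ltW.
  move=> Nm Nn; have [mn|/ltnW nm] := leqP m n.
    by rewrite -opprB; apply/op_boundedN/key.
  exact: key.
have tel n : (\Id_H - T) * u n = \Id_H - T ^+ n.
  elim: n => [|n IH]; first by rewrite /u big_ord0 mulr0 expr0 subrr.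
  rewrite /u big_ord_recr /= -/(u n) mulrDr IH mulrBl mul1r -exprS.
  by rewrite addrA subrK.
have ter n : u n * (\Id_H - T) = \Id_H - T ^+ n.
  elim: n => [|n IH]; first by rewrite /u big_ord0 mul0r expr0 subrr.
  rewrite /u big_ord_recr /= -/(u n) mulrDl IH mulrBr mulr1 -exprSr.
  by rewrite addrA subrK.
have I2 : op_bounded (\Id_H - T) (1 + r).
  apply: op_boundedD; last exact: op_boundedN.
  by move=> x; rewrite mul1r.
have r12 : 0 < 1 + r by rewrite addr_gt0.
exists G; split; apply/eqP; rewrite -subr_eq0; apply/eqP;
  apply: op_bounded_eq0 => e e0.
(* The error splits into (u n - G)(1 - T) and T^n, each at most e / 2, as 1 + r bounds 1 - T. *)
- have e2 : 0 < e / 2 by rewrite divr_gt0.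
  have [N h1] := uG _ (divr_gt0 e2 r12).
  have [N' h2] := geometric_small (ltW r0) r1 e2.
  pose n := maxn N N'.
  have -> : G * (\Id_H - T) - \Id_H = - ((u n - G) * (\Id_H - T)) - T ^+ n.
    by rewrite mulrBl ter 2!opprB -[RHS]addrA [X in _ = _ + X]addrAC subrr add0r.
  apply: (@op_bounded_ge _ _ _ (e / 2 / (1 + r) * (1 + r) + e / 2)).
    by rewrite divfK ?gt_eqF//; lra.
  apply: op_boundedD; apply: op_boundedN.
    apply: op_boundedM => //; first by rewrite ltW// divr_gt0.
    by apply: h1; rewrite leq_maxl.
  by apply: op_bounded_ge (Tn _); apply: h2; rewrite leq_maxr.
- have e2 : 0 < e / 2 by rewrite divr_gt0.
  have [N h1] := uG _ (divr_gt0 e2 r12).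
  have [N' h2] := geometric_small (ltW r0) r1 e2.
  pose n := maxn N N'.
  have -> : (\Id_H - T) * G - \Id_H = - ((\Id_H - T) * (u n - G)) - T ^+ n.
    by rewrite mulrBr tel 2!opprB -[RHS]addrA [X in _ = _ + X]addrAC subrr add0r.
  apply: (@op_bounded_ge _ _ _ ((1 + r) * (e / 2 / (1 + r)) + e / 2)).
    by rewrite mulrC divfK ?gt_eqF//; lra.
  apply: op_boundedD; apply: op_boundedN.
    apply: op_boundedM => //; first exact: ltW.
    by apply: h1; rewrite leq_maxl.
  by apply: op_bounded_ge (Tn _); apply: h2; rewrite leq_maxr.
Qed.

End Spectrum.

(** * Invertibility and spectra of symmetric operators *)

Section SelfAdjointSpectrum.
Context {R : realType} {H : hilbertType R}.
Implicit Types (x y z : H) (A B S T : bop H).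

Lemma op_invertible1 : op_invertible \Id_H.
Proof. by exists \Id_H; rewrite mulr1. Qed.

Lemma op_invertibleM A B : op_invertible A -> op_invertible B ->
  op_invertible (A * B).
Proof.
move=> [A' [l r]] [B' [l' r']]; exists (B' * A'); split.
  by rewrite mulrA -(mulrA B') l mulr1.
by rewrite mulrA -(mulrA A) r' mulr1.
Qed.

Lemma op_invertibleZ (a : R[i]) A : a != 0 -> op_invertible A ->
  op_invertible (a *: A).
Proof.
move=> a0 [A' [l r]]; exists (a^-1 *: A').
by rewrite -!bop_scalerAl -!bop_scalerAr l r !scalerA mulVf// mulfV// !scale1r.
Qed.

(** B G is a right inverse of A, G B is a left inverse by commutation, and the two coincide. *)
Lemma op_invertible_comm A B : A * B = B * A -> op_invertible (A * B) ->
  op_invertible A.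
Proof.
move=> AB [G [l r]]; exists (B * G).
have h1 : G * B * A = \Id_H by rewrite -mulrA -AB.
have h2 : A * (B * G) = \Id_H by rewrite mulrA.
split=> //; suff -> : B * G = G * B by [].
by rewrite -[LHS]mul1r -h1 -mulrA h2 mulr1.
Qed.

(** For C large, 1 - T / C lies between 0 and 1 - c / C < 1, so T = C (1 - (1 - T / C)) is inverted
    by a Neumann series. *)
Lemma op_ge_invertible T (c : R) : 0 < c -> op_le (c%:C *: \Id_H) T ->
  op_invertible T.
Proof.
move=> c0 cT.
have sT := op_le_symmetric cT.
have [d d0 Td] := op_bounded_ex T.
have [Tld _] := op_bounded_scal (ltW d0) Td sT.
(* The extra c gives c < C, hence a positive radius 1 - c / C. *)
pose C := c + d.
have C0 : 0 < C by rewrite addr_gt0.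
have CC0 : C%:C != 0 :> R[i] by rewrite gt_eqF// ltcR.
have TE : T = C%:C *: (\Id_H - (\Id_H - (C^-1)%:C *: T)).
  by rewrite subKr scalerA -rmorphM mulfV ?gt_eqF// rmorph1 scale1r.
rewrite TE; apply: op_invertibleZ => //.
apply: (@op_bounded_invertible _ _ _ (1 - c / C)).
- by rewrite subr_gt0 ltr_pdivrMr// mul1r ltrDl.
- by rewrite gtrBl divr_gt0.
apply: op_ge0_bounded.
- by rewrite subr_gt0 ltr_pdivrMr// mul1r ltrDl.
- have -> : \Id_H - C^-1%:C *: T = C^-1%:C *: (C%:C *: \Id_H - T).
    by rewrite scalerBr scalerA -rmorphM mulVf ?gt_eqF// rmorph1 scale1r.
  apply: op_ge0Z; first by rewrite invr_ge0 ltW.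
  by apply: op_le_trans Tld _; apply: op_le_scal; rewrite lerDr ltW.
- rewrite /op_le rmorphB rmorph1 scalerBl scale1r opprB addrC subrKA.
  rewrite mulrC rmorphM -scalerA -scalerBr.
  by apply: op_ge0Z => //; rewrite invr_ge0 ltW.
Qed.

(** For t < c, the operator T - t is at least c - t > 0, hence invertible. *)
Lemma real_spectrum_ge T (c : R) : op_le (c%:C *: \Id_H) T ->
  forall t, real_spectrum T t -> c <= t.
Proof.
move=> cT t st; rewrite leNgt; apply/negP => tc; apply: st.
rewrite -opprB -scaleN1r; apply: op_invertibleZ; first by rewrite oppr_eq0 oner_eq0.
apply: (@op_ge_invertible _ (c - t)); first by rewrite subr_gt0.
by rewrite rmorphB scalerBl /op_le opprB subrKA.
Qed.

Lemma real_spectrum_le T (c : R) : op_le T (c%:C *: \Id_H) ->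
  forall t, real_spectrum T t -> t <= c.
Proof.
move=> cT t st; rewrite leNgt; apply/negP => tc; apply: st.
apply: (@op_ge_invertible _ (t - c)); first by rewrite subr_gt0.
by rewrite rmorphB scalerBl /op_le opprB addrC subrKA.
Qed.

(* (z - T)(z^* - T) is bounded below by |Im z|^2. *)
Lemma spectrum_real T (z : R[i]) : op_symmetric T -> spectrum T z -> z = (complex.Re z)%:C.
Proof.
move=> sT sz; case: z sz => a b /= sz; congr (_ +i* _).
apply: contrapT => /eqP b0; apply: sz.
pose Z := (a +i* b) *: \Id_H - T; pose Z' := (a -i* b) *: \Id_H - T.
have ZZ : Z * Z' = Z' * Z.
  have -> : Z' = Z + (a -i* b - (a +i* b)) *: \Id_H.
    by rewrite scalerBl [RHS]addrC subrKA.
  clearbody Z.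
  by rewrite mulrDl mulrDr -bop_scalerAl -bop_scalerAr mul1r mulr1.
apply: (op_invertible_comm ZZ).
apply: (@op_ge_invertible _ (b ^+ 2)); first by rewrite exprn_even_gt0.
move=> x.
have adj u v : '[Z u, v] = '[u, Z' v].
  by rewrite /Z /Z' !bopB !bopE innerBl innerBr innerZl innerZr sT /Num.conj /= opprK.
rewrite bopB bopM bopZ bop1 innerBl innerZl adj.
(* With u = (Re z - T) x and Z' x = u - i b x, symmetry cancels the cross terms, leaving |Z' x|^2 =
   |u|^2 + b^2 |x|^2. *)
have -> : Z' x = (a%:C *: x - T x) + (0 -i* b) *: x.
  rewrite /Z' bopB !bopE -addrA [- _ + _]addrC addrA -scalerDl.
  by congr (_ *: _ - _); apply/eqP; rewrite eq_complex /= addr0 add0r !eqxx.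
set u := _ - T x.
have ux : '[u, x] = '[x, u].
  by rewrite /u innerBl innerBr innerZl innerZr_real sT.
clearbody u.
have wE : (0 -i* b)^*%R = - (0 -i* b) :> R[i] by apply/eqP; rewrite eq_complex /= !oppr0 !eqxx.
rewrite innerDl !innerDr !innerZl !innerZr ux wE.
set w := 0 -i* b.
rewrite [X in 0 <= X](_ : _ = '[u, u] + (- w ^+ 2 - (b ^+ 2)%:C) * '[x, x]); last by ring.
have -> : - w ^+ 2 - (b ^+ 2)%:C = 0 :> R[i].
  by apply/eqP; rewrite expr2 eq_complex /=; apply/andP; split; apply/eqP; ring.
by rewrite mul0r addr0 -sqr_normE exprn_ge0.
Qed.

(** Take the supremum of the scalar lower bounds of T. If N = T - sup L had an inverse bounded by g,
    then |x|^2 <= g^2 |N x|^2 <= g^2 d <N x, x> with d a bound of N, and the lower bound could be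
    raised by 1 / (g^2 d). *)
Lemma bottom_in_spectrum T (x0 : H) : op_symmetric T -> x0 != 0 ->
  exists2 l : R, op_le (l%:C *: \Id_H) T & real_spectrum T l.
Proof.
move=> sT x00.
have [c c0 Tc] := op_bounded_ex T.
have [Tle leT] := op_bounded_scal (ltW c0) Tc sT.
pose L := [set l : R | op_le (l%:C *: \Id_H) T]%classic.
have nx0 : 0 < '[x0, x0] by rewrite -sqr_normE exprn_gt0// normr_gt0.
(* The nonzero x0 bounds L above; on the zero space every scalar would be a lower bound. *)
have ubL : has_sup L.
  split; first by exists (- c).
  exists c => l /= lT; have := op_le_trans lT Tle x0.
  rewrite bopB !bopE -scalerBl innerZl pmulr_lge0// -rmorphB ler0c subr_ge0.
  by [].
(* The supremum is attained because the positive cone is closed. *)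
have SLe : op_le ((sup L)%:C *: \Id_H) T.
  apply: op_ge0_closed => e e0.
  have [l Ll le] := sup_adherent e0 ubL.
  exists (T - l%:C *: \Id_H); first exact: Ll.
  have lS : l <= sup L by apply: ub_le_sup Ll; exact: ubL.2.
  move=> x; rewrite opprB addrC subrKA.
  rewrite -scalerBl -rmorphB bopE bop1 normrZ normc_def /= expr0n addr0 sqrtr_sqr.
  rewrite ler_rM// ler0_norm ?subr_le0// opprB; lra.
exists (sup L) => // -[G [l _]].
pose N := T - (sup L)%:C *: \Id_H.
have N0 : op_ge0 N by [].
have [g g0 Gg] := op_bounded_ex G.
have [d d0 Nd] := op_bounded_ex N.
have [Nle _] := op_bounded_scal (ltW d0) Nd (op_ge0_symmetric N0).
have k0 : 0 < (g ^+ 2 * d)^-1 by rewrite invr_gt0 mulr_gt0// exprn_gt0.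
have : L (sup L + (g ^+ 2 * d)^-1).
  rewrite /L /=; have : op_le ((g ^+ 2 * d)^-1%:C *: \Id_H) N.
    move=> x; rewrite bopB bopZ bop1 innerBl innerZl subr_ge0.
    have kC : 0 < (g ^+ 2 * d)%:C :> R[i] by rewrite ltcR -invr_gt0.
    rewrite fmorphV ler_pdivrMl// rmorphM rmorphXn -mulrA -sqr_normE.
    apply: le_trans (ler_wpM2l _ (op_ge0_sqr_norm d0 N0 Nle x)); last first.
      by rewrite exprn_ge0// ler0c ltW.
    rewrite -exprMn lerXn2r ?nnegrE ?mulr_ge0 ?ler0c ?(ltW g0)//.
    have xE : x = G (- N x).
      by rewrite -bopN /N opprB -bopM l bop1.
    by rewrite {1}xE (le_trans (Gg _))// normrN.
  rewrite /op_le /N => h; rewrite rmorphD scalerDl opprD addrA; exact: h.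
move/(ub_le_sup ubL.2).
by rewrite gerDl leNgt k0.
Qed.

End SelfAdjointSpectrum.

(** * Polynomials of an operator *)

Section PolynomialCalculus.
Context {R : realType} {H : hilbertType R}.
Implicit Types (x y : H) (A B S T : bop H).

(** Complex coefficients let polynomials split into linear factors; [op_horner] is the real case. *)
Definition cpoly_op (P : {poly R[i]}) A : bop H :=
  \sum_(k < size P) P`_k *: A ^+ k.

Lemma cpoly_opE n (P : {poly R[i]}) A : (size P <= n)%N ->
  cpoly_op P A = \sum_(k < n) P`_k *: A ^+ k.
Proof.
move=> Pn; rewrite /cpoly_op (big_ord_widen n (fun k => P`_k *: A ^+ k))// big_mkcond.
apply: eq_bigr => k _; case: ltnP => // kP.
by rewrite nth_default// scale0r.
Qed.

Lemma cpoly_opD P Q A : cpoly_op (P + Q) A = cpoly_op P A + cpoly_op Q A.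
Proof.
pose n := maxn (size P) (size Q).
rewrite (@cpoly_opE n) ?size_polyD// (@cpoly_opE n P) ?leq_maxl//.
rewrite (@cpoly_opE n Q) ?leq_maxr// -big_split; apply: eq_bigr => k _.
by rewrite coefD scalerDl.
Qed.

Lemma cpoly_opZ a P A : cpoly_op (a *: P) A = a *: cpoly_op P A.
Proof.
rewrite (@cpoly_opE (size P)) ?size_scale_leq// scaler_sumr.
by apply: eq_bigr => k _; rewrite coefZ scalerA.
Qed.

Lemma cpoly_opC c A : cpoly_op c%:P A = c *: \Id_H.
Proof.
rewrite (@cpoly_opE 1) ?size_polyC_leq1// big_ord1 coefC eqxx.
by rewrite expr0.
Qed.

Lemma cpoly_opMX P A : cpoly_op (P * 'X) A = cpoly_op P A * A.
Proof.
rewrite (@cpoly_opE (size P).+1); last first.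
  by rewrite (leq_trans (size_polyMleq _ _))// size_polyX addn2.
rewrite big_ord_recl coefMX eqxx scale0r add0r mulr_suml.
by apply: eq_bigr => k _; rewrite coefMX /= -bop_scalerAl exprSr.
Qed.

Lemma cpoly_opM_XsubC P z A :
  cpoly_op (P * ('X - z%:P)) A = cpoly_op P A * (A - z *: \Id_H).
Proof.
rewrite mulrBr cpoly_opD cpoly_opMX mulrBr; congr (_ + _).
by rewrite -scaleN1r cpoly_opZ scaleN1r mulrC mul_polyC cpoly_opZ -bop_scalerAr mulr1.
Qed.

Lemma cpoly_op_prod_invertible (s : seq R[i]) A :
  (forall z, z \in s -> op_invertible (z *: \Id_H - A)) ->
  op_invertible (cpoly_op (\prod_(z <- s) ('X - z%:P)) A).
Proof.
elim: s => [_|z s IH sA].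
  by rewrite big_nil -[1]/(1%:P) cpoly_opC scale1r; exact: op_invertible1.
rewrite big_cons mulrC cpoly_opM_XsubC; apply: op_invertibleM.
  by apply: IH => u us; apply: sA; rewrite inE us orbT.
rewrite -opprB -scaleN1r; apply: op_invertibleZ; first by rewrite oppr_eq0 oner_eq0.
by apply: sA; rewrite inE eqxx.
Qed.

(** Half of the spectral mapping theorem: P splits over the complex numbers, and each factor A - z
    is invertible. *)
Lemma cpoly_op_invertible P A : P != 0 ->
  (forall z, root P z -> op_invertible (z *: \Id_H - A)) ->
  op_invertible (cpoly_op P A).
Proof.
move=> P0 PA; have [s Ps] := closed_field_poly_normal P.
rewrite Ps cpoly_opZ; apply: op_invertibleZ; first by rewrite lead_coef_eq0.
apply: cpoly_op_prod_invertible => z zs; apply: PA.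
by rewrite Ps rootZ ?lead_coef_eq0// root_prod_XsubC.
Qed.

Local Notation toC := (map_poly (real_complex R)).

Lemma op_horner_cpoly (P : {poly R}) A : op_horner P A = cpoly_op (toC P) A.
Proof.
rewrite /op_horner /cpoly_op size_map_poly; apply: eq_bigr => k _.
by rewrite coef_map.
Qed.

Lemma op_hornerD P Q A : op_horner (P + Q) A = op_horner P A + op_horner Q A.
Proof. by rewrite !op_horner_cpoly rmorphD cpoly_opD. Qed.

Lemma op_hornerZ c P A : op_horner (c *: P) A = c%:C *: op_horner P A.
Proof. by rewrite !op_horner_cpoly map_polyZ cpoly_opZ. Qed.

Lemma op_hornerN P A : op_horner (- P) A = - op_horner P A.
Proof. by rewrite -scaleN1r op_hornerZ rmorphN1 scaleN1r. Qed.

Lemma op_hornerC c A : op_horner c%:P A = c%:C *: \Id_H.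
Proof. by rewrite op_horner_cpoly map_polyC cpoly_opC. Qed.

Lemma op_hornerX A : op_horner 'X A = A.
Proof.
rewrite op_horner_cpoly map_polyX -[X in cpoly_op X]mul1r cpoly_opMX.
by rewrite -[1]/(1%:P) cpoly_opC scale1r mul1r.
Qed.

Lemma op_horner_symmetric P T : op_symmetric T -> op_symmetric (op_horner P T).
Proof.
move=> sT; rewrite /op_horner; elim/big_ind : _.
- exact: symmetric0.
- exact: symmetricD.
- by move=> k _; apply/symmetricZ/symmetricX.
Qed.

(* The bottom of the spectrum of P(T) is P(t) for some t in the spectrum of T. *)
Lemma op_horner_ge0 P T : op_symmetric T ->
  (forall t, real_spectrum T t -> 0 <= P.[t]) -> op_ge0 (op_horner P T).
Proof.
move=> sT PT.
have [[x0 x00]|H0] := pselect (exists x : H, x != 0); last first.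
  move=> x; have -> : x = 0 by apply: contrapT => /eqP ?; apply: H0; exists x.
  by rewrite inner0r.
have [l lP sl] := bottom_in_spectrum (op_horner_symmetric P sT) x00.
suff l0 : 0 <= l.
  rewrite -[op_horner P T](subrK (l%:C *: \Id_H)); apply: op_ge0D lP _.
  by apply: op_ge0Z l0 op_ge0_1.
(* If P is the constant l there is nothing to factor; the spectrum of T is nonempty, and P is
   nonnegative there. *)
have [Pl|Pl] := eqVneq (P - l%:P) 0.
  have [t _ st] := bottom_in_spectrum sT x00.
  by have := PT t st; move/subr0_eq : Pl => ->; rewrite hornerC.
apply: contrapT => /negP l0; apply: sl.
rewrite -opprB -scaleN1r; apply: op_invertibleZ; first by rewrite oppr_eq0 oner_eq0.
rewrite -(op_hornerC _ T) -op_hornerN -op_hornerD op_horner_cpoly.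
apply: cpoly_op_invertible; first by rewrite map_poly_eq0.
(* A root z of P - l in the spectrum of T would be real, so l = P(z) >= 0, a contradiction. *)
move=> z rz; apply: contrapT => sz.
have zE := spectrum_real sT sz.
apply: (negP l0); move: rz; rewrite zE /root horner_map fmorph_eq0.
rewrite hornerD hornerN hornerC subr_eq0 => /eqP <-; apply: PT.
by rewrite /real_spectrum /= -zE.
Qed.

Lemma op_horner_le P Q T : op_symmetric T ->
  (forall t, real_spectrum T t -> P.[t] <= Q.[t]) ->
  op_le (op_horner P T) (op_horner Q T).
Proof.
move=> sT PQ; rewrite /op_le -op_hornerN -op_hornerD.
by apply: op_horner_ge0 => // t st; rewrite hornerD hornerN subr_ge0 PQ.
Qed.

Lemma op_horner_bounded P T (c : R) : op_symmetric T -> 0 < c ->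
  (forall t, real_spectrum T t -> `|P.[t]| <= c) ->
  op_bounded (op_horner P T) (3 * c).
Proof.
move=> sT c0 Pc; apply: symmetric_bounded => //.
  rewrite -(op_hornerC _ T); apply: op_horner_le => // t /Pc.
  by rewrite hornerC ler_norml => /andP[].
rewrite -(op_hornerC _ T); apply: op_horner_le => // t /Pc.
by rewrite hornerC ler_norml => /andP[].
Qed.

End PolynomialCalculus.

(** * Functional calculus *)

Lemma uniform_cvg_nat {R : realType} (D : set R) (u : nat -> R -> R) (f : R -> R) :
  {uniform D, u @ \oo --> f}%classic <->
  forall e : R, 0 < e -> exists N, forall n, (N <= n)%N ->
    forall t, D t -> `|f t - u n t| <= e.
Proof.
split=> [uf e e0|uf].
  have /uf[N _ uN] : nbhs (f : {uniform` D -> R})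
      [set h | forall t, D t -> `|f t - h t| <= e]%classic.
    apply/uniform_nbhs; exists [set xy | `|xy.1 - xy.2| <= e]%classic; split=> //.
    apply: (filterS _ (entourage_ball R (PosNum e0))) => -[x y] /=.
    by rewrite -ball_normE /= => /ltW.
  by exists N => n Nn; exact: uN.
move=> B /uniform_nbhs[E [entE EB]].
move: entE; rewrite -entourage_ballE => -[e /= e0 eE].
(* Halving e turns the large inequality into the strict one of a ball. *)
have [N uN] := uf _ (divr_gt0 e0 (ltr0n R 2)).
exists N => // n Nn; apply: EB => t Dt /=.
apply: eE => /=; rewrite -ball_normE /=.
by apply: le_lt_trans (uN n Nn t Dt) _; lra.
Qed.

Section FunctionalCalculus.
Context {R : realType} {H : hilbertType R}.
Implicit Types (x y : H) (A B S T : bop H).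

Lemma Re_norm x : (complex.Re `|x|)%:C = `|x|.
Proof. by rewrite RRe_real ?normr_real. Qed.

Lemma opnorm_le A (c : R) : 0 <= c -> op_bounded A c -> opnorm A <= c.
Proof.
move=> c0 Ac; apply: ge_sup.
  by exists (complex.Re `|A 0|); exists 0 => //=; rewrite normr0 ler01.
move=> _ [x /= x1 <-]; rewrite -lecR Re_norm (le_trans (Ac x))//.
by rewrite -[leRHS]mulr1 ler_wpM2l// ler0c.
Qed.

Lemma op_bounded_opnorm A : op_bounded A (opnorm A).
Proof.
move=> x; have [->|x0] := eqVneq x 0; first by rewrite bop_at0 !normr0 mulr0.
have nx : 0 < `|x| by rewrite normr_gt0.
have [c c0 Ac] := op_bounded_ex A.
rewrite -ler_pdivrMr//.
have -> : `|A x| / `|x| = `|A (`|x|^-1 *: x)|.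
  by rewrite bop_atZ normrZ normfV normr_id mulrC.
rewrite -Re_norm lecR; apply: ub_le_sup.
  exists c => _ [y /= y1 <-]; rewrite -lecR Re_norm (le_trans (Ac y))//.
  by rewrite -[leRHS]mulr1 ler_wpM2l// ler0c ltW//.
by exists (`|x|^-1 *: x) => //=; rewrite normrZ normfV normr_id mulVf// gt_eqF.
Qed.

Lemma opnorm_ge0 A : 0 <= opnorm A.
Proof.
have [c c0 Ac] := op_bounded_ex A.
have -> : 0 = complex.Re `|A 0| by rewrite bop_at0 normr0.
apply: ub_le_sup; last by exists 0 => //=; rewrite normr0 ler01.
exists c => _ [y /= y1 <-]; rewrite -lecR Re_norm (le_trans (Ac y))//.
by rewrite -[leRHS]mulr1 ler_wpM2l// ler0c ltW//.
Qed.

Lemma opnorm_cvg0 (u : nat -> bop H) :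
  (opnorm (u k) @[k --> \oo] --> (0 : R))%classic <->
  forall e : R, 0 < e -> exists N, forall n, (N <= n)%N -> op_bounded (u n) e.
Proof.
split=> [/cvgrPdist_le u0 e /u0[N _ uN]|u0].
  exists N => n /uN /=; rewrite sub0r normrN ger0_norm ?opnorm_ge0// => h.
  exact: op_bounded_ge h (op_bounded_opnorm _).
apply/cvgrPdist_le => e e0; have [N uN] := u0 _ e0; exists N => // n Nn /=.
rewrite sub0r normrN ger0_norm ?opnorm_ge0//.
exact: opnorm_le (ltW e0) (uN n Nn).
Qed.

Variables (T : bop H) (f : R -> R) (P : nat -> {poly R}).
Hypothesis sT : op_symmetric T.
Hypothesis Pf : forall e : R, 0 < e -> exists N, forall n, (N <= n)%N ->
  forall t, real_spectrum T t -> `|f t - (P n).[t]| <= e.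

(** The operators P_n(T) are Cauchy, so a limit B exists and the [xget] in [fcalc] does not fall
    back on 0. The sequence Q that comes with the chosen operator may differ from P. *)
Lemma fcalc_approx : exists Q : nat -> {poly R},
  (forall e : R, 0 < e -> exists N, forall n, (N <= n)%N ->
    forall t, real_spectrum T t -> `|f t - (Q n).[t]| <= e) /\
  (forall e : R, 0 < e -> exists N, forall n, (N <= n)%N ->
    op_bounded (op_horner (Q n) T - fcalc f T) e).
Proof.
have [B PB] : exists B, forall e : R, 0 < e -> exists N, forall n, (N <= n)%N ->
    op_bounded (op_horner (P n) T - B) e.
  apply: op_cauchy_cvg => e e0.
  (* Two errors e / 6, multiplied by the 3 of [op_horner_bounded], make e. *)
  have e6 : 0 < e / 6 by rewrite divr_gt0.
  have [N PN] := Pf e6; exists N => m n Nm Nn.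
  rewrite -op_hornerN -op_hornerD.
  apply: (@op_bounded_ge _ _ _ (3 * (e / 6 + e / 6))); first lra.
  apply: op_horner_bounded => //; first lra.
  move=> t st; rewrite hornerD hornerN -(subrKA (f t)).
  by rewrite (le_trans (ler_normD _ _))// lerD// ?PN// distrC PN.
have : exists Q : nat -> {poly R},
    ({uniform real_spectrum T, (fun k t => (Q k).[t]) @ \oo --> f} /\
    opnorm (op_horner (Q k) T - fcalc f T) @[k --> \oo] --> (0 : R))%classic.
  rewrite /fcalc; case: xgetP => [//|] /(_ B) []; exists P; split.
    exact/uniform_cvg_nat.
  exact/opnorm_cvg0.
by move=> [Q [/uniform_cvg_nat h1 /opnorm_cvg0 h2]]; exists Q.
Qed.

(** On the spectrum L <= f <= Q_n + e / 2, so Q_n(T) + e / 2 - L(T) is nonnegative; it is within e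
    of [fcalc f T] - L(T). *)
Lemma op_horner_le_fcalc (L : {poly R}) :
  (forall t, real_spectrum T t -> L.[t] <= f t) ->
  op_le (op_horner L T) (fcalc f T).
Proof.
move=> Lf; have [Q [Qf QB]] := fcalc_approx.
apply: op_ge0_closed => e e0.
have e2 : 0 < e / 2 by rewrite divr_gt0.
have [N QN] := Qf _ e2; have [N' QN'] := QB _ e2.
pose n := maxn N N'.
exists (op_horner (Q n) T + (e / 2)%:C *: \Id_H - op_horner L T).
  rewrite -(op_hornerC _ T) -op_hornerD; apply: op_horner_le => // t st.
  rewrite hornerD hornerC; apply: le_trans (Lf t st) _.
  have := QN n (leq_maxl _ _) t st; rewrite ler_norml => /andP[_].
  by rewrite lerBlDr addrC.
apply: (@op_bounded_ge _ _ _ (e / 2 + e / 2)); first lra.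
rewrite opprB addrA subrK opprD addrA.
apply: op_boundedD.
  by rewrite -opprB; apply/op_boundedN/QN'; rewrite leq_maxr.
apply: op_boundedN => x; rewrite bopZ bop1 normrZ ger0_norm// ler0c ltW//.
Qed.

Lemma fcalc_le_op_horner (L : {poly R}) :
  (forall t, real_spectrum T t -> f t <= L.[t]) ->
  op_le (fcalc f T) (op_horner L T).
Proof.
move=> Lf; have [Q [Qf QB]] := fcalc_approx.
apply: op_ge0_closed => e e0.
have e2 : 0 < e / 2 by rewrite divr_gt0.
have [N QN] := Qf _ e2; have [N' QN'] := QB _ e2.
pose n := maxn N N'.
exists (op_horner L T - (op_horner (Q n) T - (e / 2)%:C *: \Id_H)).
  rewrite -(op_hornerC _ T) -op_hornerN -op_hornerD; apply: op_horner_le => // t st.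
  rewrite hornerD hornerN hornerC; apply: le_trans (Lf t st).
  have := QN n (leq_maxl _ _) t st; rewrite ler_norml => /andP[+ _].
  lra.
apply: (@op_bounded_ge _ _ _ (e / 2 + e / 2)); first lra.
rewrite opprB addrC subrKA addrAC.
apply: op_boundedD; first by apply/QN'; rewrite leq_maxr.
apply: op_boundedN => x; rewrite bopZ bop1 normrZ ger0_norm// ler0c ltW//.
Qed.

End FunctionalCalculus.

(** * Polynomial approximation of powers *)

Section PowerApproximation.
Context {R : realType}.
Implicit Types (p u x t : R).

(** Young's inequality for the product of u^p and 1, with exponents 1 / p and 1 / (1 - p). *)
Lemma powR_le_tangent p u : 0 < p -> p < 1 -> 0 <= u ->
  u `^ p <= 1 + p * (u - 1).
Proof.
move=> p0 p1 u0.
have q0 : 0 < 1 - p by rewrite subr_gt0.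
have := @conjugate_powR _ (u `^ p) 1 p^-1 (1 - p)^-1 (powR_ge0 _ _) ler01.
rewrite !invr_gt0 !invrK -powRrM mulfV ?gt_eqF// powRr1// powR1 mulr1 mul1r.
move=> /(_ p0 q0); rewrite addrC subrK => /(_ erefl) h; apply: le_trans h _.
by rewrite le_eqVlt; apply/orP; left; apply/eqP; ring.
Qed.

(* Apply the tangent inequality to u^-1. *)
Lemma powR_ge_quadratic p u : 0 < p -> p < 1 -> 0 <= u ->
  1 + p * (u - 1) - (1 - p) * (u - 1) ^+ 2 <= u `^ p.
Proof.
move=> p0 p1; rewrite le_eqVlt => /predU1P[<-|u0].
  by rewrite powR0 ?gt_eqF// sub0r sqrrN expr1n; lra.
have d0 : 0 < 1 + (1 - p) * (u - 1) by nra.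
have up : 0 < u `^ p by rewrite powR_gt0.
(* This is u^(-p) <= 1 + p (u^-1 - 1) multiplied by u u^p. *)
have h1 : u <= u `^ p * (1 + (1 - p) * (u - 1)).
  have := powR_le_tangent p0 p1 (ltW (_ : 0 < u^-1)).
  rewrite invr_gt0 => /(_ u0).
  have -> : u^-1 `^ p = (u `^ p)^-1 by rewrite -powR_inv1 ?ltW// -powRrM mulN1r powRN.
  rewrite -(ler_pM2l up) mulfV ?gt_eqF// => h.
  rewrite -[X in X <= _]mul1r -[leRHS](mulfVK (lt0r_neq0 u0)) ler_pM2r//.
  apply: le_trans h _; rewrite -mulrA ler_wpM2l ?(ltW up)//.
  by rewrite le_eqVlt; apply/orP; left; apply/eqP; field; rewrite gt_eqF.
(* Multiplied by 1 + (1 - p) v, the quadratic falls short of u by (1 - p)^2 v^2 (1 + v). *)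
rewrite -(ler_pM2r d0); apply: le_trans h1.
set v := u - 1.
have vE : u = 1 + v by rewrite /v addrC subrK.
rewrite vE.
have v1 : 0 < 1 + v by rewrite -vE.
have -> : (1 + p * v - (1 - p) * v ^+ 2) * (1 + (1 - p) * v) =
  (1 + v) - (1 - p) ^+ 2 * v ^+ 2 * (1 + v) by ring.
by rewrite gerBl; apply: mulr_ge0 (ltW v1); rewrite mulr_ge0 ?sqr_ge0.
Qed.

(* The n-th Bernstein operator with nodes 0, ..., n, as the mean of g over n
   tosses of a coin of bias 'X. *)
Fixpoint bernstein (n : nat) (g : R -> R) : {poly R} :=
  if n is n'.+1
  then 'X * bernstein n' (fun k => g (k + 1)) + (1 - 'X) * bernstein n' g
  else (g 0)%:P.

Lemma bernstein_le n (f g : R -> R) x : 0 <= x -> x <= 1 ->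
  (forall k, 0 <= k -> f k <= g k) -> (bernstein n f).[x] <= (bernstein n g).[x].
Proof.
move=> x0 x1; elim: n f g => [|n IH] f g fg /=; first by rewrite !hornerC fg.
rewrite !hornerE lerD// ler_wpM2l ?subr_ge0//; last exact: IH.
by apply: IH => k k0; apply: fg; rewrite addr_ge0.
Qed.

(** Moments of the binomial law: mean n x and variance n x (1 - x). *)
Lemma bernstein_quadratic n (a b c : R) x :
  (bernstein n (fun k => a + b * k + c * k ^+ 2)).[x] =
  a + b * (n%:R * x) + c * ((n%:R * x) ^+ 2 + n%:R * x * (1 - x)).
Proof.
elim: n a b c => [|n IH] a b c /=; first by rewrite hornerC; ring.
(* A shifted quadratic is a quadratic, so the induction runs over all coefficients. *)
have -> : (fun k : R => a + b * (k + 1) + c * (k + 1) ^+ 2) =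
    (fun k => (a + b + c) + (b + 2 * c) * k + c * k ^+ 2).
  by apply/funext => k; ring.
by rewrite !(hornerD, hornerN, hornerM, hornerX, hornerC) !IH -natr1; ring.
Qed.

Definition powR_poly p n : {poly R} := bernstein n (fun k => (k / n%:R) `^ p).

(* 1 + p v - (1 - p) v^2 <= (1 + v)^p <= 1 + p v, with 1 + v = k / (n t). *)
Lemma powR_poly_approx p n t : 0 < p -> p < 1 -> (0 < n)%N -> 0 < t -> t <= 1 ->
  `|t `^ p - (powR_poly p n).[t]| <= (n%:R * t)^-1.
Proof.
move=> p0 p1 n0 t0 t1.
have nR : 0 < n%:R :> R by rewrite ltr0n.
have nt : 0 < n%:R * t by rewrite mulr_gt0.
have tp0 : 0 <= t `^ p by exact: powR_ge0.
have tp1 : t `^ p <= 1 by have := powR_le_tangent p0 p1 (ltW t0); nra.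
(* Factoring out t^p leaves the variable k / (n t), of mean 1. *)
have scale (k : R) : 0 <= k -> (k / n%:R) `^ p = t `^ p * (k / (n%:R * t)) `^ p.
  move=> k0; rewrite -powRM ?(ltW t0)//; last by rewrite divr_ge0// ltW.
  by congr (_ `^ _); field; rewrite gt_eqF//= gt_eqF.
have hi : (powR_poly p n).[t] <= t `^ p.
  apply: (@le_trans _ _ (bernstein n (fun k =>
      t `^ p * (1 - p) + t `^ p * p / (n%:R * t) * k + 0 * k ^+ 2)).[t]).
    apply: bernstein_le; rewrite ?(ltW t0)// => k k0; rewrite scale//.
    have k1 : 0 <= k / (n%:R * t) by rewrite divr_ge0// ltW.
    apply: le_trans (ler_wpM2l tp0 (powR_le_tangent p0 p1 k1)) _.
    by rewrite le_eqVlt; apply/orP; left; apply/eqP; field; rewrite !gt_eqF.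
  rewrite bernstein_quadratic.
  by rewrite le_eqVlt; apply/orP; left; apply/eqP; field; rewrite !gt_eqF.
(* The loss is t^p (1 - p) times the variance (1 - t) / (n t) of k / (n t). *)
have lo : t `^ p - t `^ p * (1 - p) * (1 - t) / (n%:R * t) <= (powR_poly p n).[t].
  apply: (@le_trans _ _ (bernstein n (fun k =>
      t `^ p * (1 - p - (1 - p)) + t `^ p * (p + 2 * (1 - p)) / (n%:R * t) * k +
      (- (t `^ p * (1 - p) / (n%:R * t) ^+ 2)) * k ^+ 2)).[t]).
    rewrite bernstein_quadratic.
    by rewrite le_eqVlt; apply/orP; left; apply/eqP; field; rewrite !gt_eqF.
  apply: bernstein_le; rewrite ?(ltW t0)// => k k0; rewrite scale//.
  have k1 : 0 <= k / (n%:R * t) by rewrite divr_ge0// ltW.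
  apply: le_trans (ler_wpM2l tp0 (powR_ge_quadratic p0 p1 k1)).
  by rewrite le_eqVlt; apply/orP; left; apply/eqP; field; rewrite !gt_eqF.
rewrite ger0_norm ?subr_ge0// lerBlDr -lerBlDl; apply: le_trans lo.
rewrite lerD2l lerN2 ler_pdivrMr// mulVf ?gt_eqF//.
by rewrite !mulr_ile1 ?mulr_ge0 ?subr_ge0 ?gerBl ?(ltW p1) ?(ltW p0) ?(ltW t0).
Qed.

End PowerApproximation.

(** * The chord and tangent bounds *)

Section ScalarBounds.
Context {R : realType}.
Implicit Types (p a b t al : R).

(** Homogeneity reduces the tangent at s to the one at 1. *)
Lemma powR_le_tangent_at p s t : 0 < p -> p < 1 -> 0 < s -> 0 <= t ->
  t `^ p <= s `^ p * (1 + p * (t / s - 1)).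
Proof.
move=> p0 p1 s0 t0.
have ts : 0 <= t / s by rewrite divr_ge0// ltW.
rewrite -{1}(divfK (lt0r_neq0 s0) t) powRM ?(ltW s0)// mulrC.
by rewrite ler_wpM2l ?powR_ge0 ?powR_le_tangent.
Qed.

(* t^p - al t is maximal where p t^(p - 1) = al. *)
Lemma powR_le_affine p al t : 0 < p -> p < 1 -> 0 < al -> 0 <= t ->
  t `^ p <= al * t + (1 - p) * (p^-1 * al) `^ (p / (p - 1)).
Proof.
move=> p0 p1 al0 t0.
have q0 : 0 < p^-1 * al by rewrite mulr_gt0// invr_gt0.
have p1' : p - 1 != 0 by rewrite subr_eq0 lt_eqF.
(* The critical point, where p s^(p - 1) = al: the tangent at s has slope al and intercept (1 - p)
   s^p. *)
pose s := (p^-1 * al) `^ (p - 1)^-1.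
have s0 : 0 < s by rewrite powR_gt0.
have sp : s `^ p = (p^-1 * al) `^ (p / (p - 1)) by rewrite /s -powRrM [_ * p]mulrC.
have sp1 : s `^ p = p^-1 * al * s.
  rewrite -{1}(subrK 1 p) powRD; last by rewrite (gt_eqF s0) implybT.
  by rewrite {1}/s -powRrM mulVf// !powRr1 ?ltW.
rewrite -sp; apply: le_trans (powR_le_tangent_at p0 p1 s0 t0) _.
rewrite le_eqVlt; apply/orP; left; apply/eqP.
rewrite sp1; field.
by rewrite !gt_eqF.
Qed.

Definition chord_slope p a b := (b `^ p - a `^ p) / (b - a).
Definition chord_offset p a b := (b * a `^ p - a * b `^ p) / (b - a).

(** Concavity: a^p and b^p lie below the tangent at t, and averaging its values at a and b with
    barycentre t gives t^p. *)
Lemma chord_le_powR p a b t : 0 < p -> p < 1 -> 0 < a -> a < b ->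
  a <= t <= b -> chord_slope p a b * t + chord_offset p a b <= t `^ p.
Proof.
move=> p0 p1 a0 ab /andP[at_ tb].
have t0 : 0 < t by exact: lt_le_trans at_.
have ba0 : 0 < b - a by rewrite subr_gt0.
have b0 : 0 < b by exact: lt_trans ab.
have -> : chord_slope p a b * t + chord_offset p a b =
    ((b - t) * a `^ p + (t - a) * b `^ p) / (b - a).
  by rewrite /chord_slope /chord_offset; field; rewrite gt_eqF.
rewrite ler_pdivrMr//.
have -> : t `^ p * (b - a) = (b - t) * (t `^ p * (1 + p * (a / t - 1))) +
    (t - a) * (t `^ p * (1 + p * (b / t - 1))).
  by field; rewrite gt_eqF.
by apply: lerD; rewrite ler_wpM2l ?subr_ge0// powR_le_tangent_at// ltW.
Qed.

Lemma chord_slope_gt0 p a b : 0 < p -> 0 < a -> a < b -> 0 < chord_slope p a b.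
Proof.
move=> p0 a0 ab; rewrite divr_gt0 ?subr_gt0// gt0_ltr_powR// nnegrE ltW//.
exact: lt_trans ab.
Qed.

(** Reads [delta] as the gap between the tangent parallel to the chord over [1 - M, 1 - m] and that
    chord. *)
Lemma deltaE m M p : delta m M p =
  (1 - p) * (p^-1 * chord_slope p (1 - M) (1 - m)) `^ (p / (p - 1)) -
  chord_offset p (1 - M) (1 - m).
Proof.
rewrite /delta /chord_slope /chord_offset.
have -> : 1 - m - (1 - M) = M - m by ring.
by congr (_ + _); rewrite -[RHS]mulNr; congr (_ * _); ring.
Qed.

End ScalarBounds.

(** * Affine bounds for powers of an operator *)

Section OperatorPower.
Context {R : realType} {H : hilbertType R}.
Variables (p a b : R) (T : bop H).
Hypotheses (p0 : 0 < p) (p1 : p < 1) (a0 : 0 < a) (ab : a < b) (b1 : b <= 1).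
Hypotheses (aT : op_le (a%:C *: \Id_H) T) (Tb : op_le T (b%:C *: \Id_H)).

Let sT : op_symmetric T := op_le_symmetric aT.

Let spectrum_itv t : real_spectrum T t -> a <= t <= b.
Proof.
by move=> st; rewrite (real_spectrum_ge aT st) (real_spectrum_le Tb st).
Qed.

(** The error (n t)^-1 is uniform on the spectrum because t >= a > 0; the index [n.+1] avoids n =
    0. *)
Let approx (e : R) : 0 < e -> exists N, forall n, (N <= n)%N ->
  forall t, real_spectrum T t -> `|t `^ p - (powR_poly p n.+1).[t]| <= e.
Proof.
move=> e0; exists (Num.bound (e * a)^-1) => n Nn t /spectrum_itv/andP[at_ tb].
have t0 : 0 < t by exact: lt_le_trans at_.
apply: le_trans (powR_poly_approx p0 p1 (ltn0Sn n) t0 (le_trans tb b1)) _.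
have ea0 : 0 < e * a by rewrite mulr_gt0.
rewrite invf_ple ?posrE ?mulr_gt0// -(ler_pM2r a0).
have h : (e * a)^-1 <= n.+1%:R.
  apply: le_trans (ltW (archi_boundP _)) _; first by rewrite invr_ge0 ltW.
  by rewrite ler_nat ltnW.
have -> : e^-1 * a = (e * a)^-1 * a * a by field; rewrite !gt_eqF.
rewrite ler_pM2r//; apply: ler_pM => //; last exact: ltW.
by rewrite invr_ge0 ltW.
Qed.

Lemma op_horner_affine (al be : R) :
  op_horner (al *: 'X + be%:P) T = al%:C *: T + be%:C *: \Id_H.
Proof. by rewrite op_hornerD op_hornerZ op_hornerX op_hornerC. Qed.

Lemma chord_le_op_powR : op_le
  ((chord_slope p a b)%:C *: T + (chord_offset p a b)%:C *: \Id_H) (op_powR T p).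
Proof.
rewrite -op_horner_affine; apply: (op_horner_le_fcalc sT approx) => t st.
by rewrite !hornerE chord_le_powR// spectrum_itv.
Qed.

Lemma op_powR_le_affine (al : R) : 0 < al -> op_le (op_powR T p)
  (al%:C *: T + ((1 - p) * (p^-1 * al) `^ (p / (p - 1)))%:C *: \Id_H).
Proof.
move=> al0; rewrite -op_horner_affine.
apply: (fcalc_le_op_horner sT approx) => t st; rewrite !hornerE.
apply: powR_le_affine => //; have /andP[at_ _] := spectrum_itv st.
by rewrite (le_trans (ltW a0)).
Qed.

End OperatorPower.

(** * Unital positive maps and the weighted inequality *)

Section PositiveMaps.
Context {R : realType} {H K : hilbertType R}.
Implicit Type Phi : {linear bop H -> bop K}.

Lemma positive_map_le Phi A B : positive_map Phi -> op_le A B ->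
  op_le (Phi A) (Phi B).
Proof. by move=> P0 AB; rewrite /op_le -linearB; exact: P0. Qed.

Lemma unital_map_scal Phi c : unital_map Phi -> Phi (c *: \Id_H) = c *: \Id_K.
Proof. by move=> P1; rewrite linearZ /= P1. Qed.

Lemma sum_weights n (w : 'I_n -> R) (A : bop K) :
  \sum_(j < n) w j = 1 -> \sum_(j < n) (w j)%:C *: A = A.
Proof. by move=> w1; rewrite -scaler_suml -rmorph_sum w1 rmorph1 scale1r. Qed.

Variables (m M p : R) (n : nat).
Variables (A : 'I_n -> bop H) (Phi : 'I_n -> {linear bop H -> bop K}).
Variable w : 'I_n -> R.
Hypotheses (m0 : 0 <= m) (mM : m < M) (M1 : M < 1).
Hypothesis Abd : forall j,
  op_le (m%:C *: \Id_H) (A j) /\ op_le (A j) (M%:C *: \Id_H).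
Hypothesis Phi_ge0 : forall j, positive_map (Phi j).
Hypothesis Phi1 : forall j, unital_map (Phi j).
Hypotheses (w0 : forall j, 0 < w j) (w1 : \sum_(j < n) w j = 1).
Hypotheses (p0 : 0 < p) (p1 : p < 1).

Lemma sum_positive_map_powR : op_le
  (op_powR (\sum_(j < n) (w j)%:C *: Phi j (\Id_H - A j)) p)
  ((delta m M p)%:C *: \Id_K +
     \sum_(j < n) (w j)%:C *: Phi j (op_powR (\Id_H - A j) p)).
Proof.
have a0 : 0 < 1 - M by rewrite subr_gt0.
have ab : 1 - M < 1 - m by rewrite ltrD2l ltrN2.
have b1 : 1 - m <= 1 by rewrite gerBl.
have aX j : op_le ((1 - M)%:C *: \Id_H) (\Id_H - A j).
  rewrite /op_le rmorphB rmorph1 scalerBl scale1r opprB addrC subrKA.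
  exact: (Abd j).2.
have Xb j : op_le (\Id_H - A j) ((1 - m)%:C *: \Id_H).
  rewrite /op_le rmorphB rmorph1 scalerBl scale1r opprB addrC subrKA.
  exact: (Abd j).1.
set S := \sum_(j < n) (w j)%:C *: Phi j (\Id_H - A j).
have wC j : 0 <= w j by exact: ltW.
have aS : op_le ((1 - M)%:C *: \Id_K) S.
  rewrite -(sum_weights (_ *: _) w1); apply: op_le_sum => j.
  by apply: op_leZ => //; rewrite -(unital_map_scal _ (Phi1 j)); exact: positive_map_le.
have Sb : op_le S ((1 - m)%:C *: \Id_K).
  rewrite -(sum_weights (_ *: _) w1); apply: op_le_sum => j.
  by apply: op_leZ => //; rewrite -(unital_map_scal _ (Phi1 j)); exact: positive_map_le.
pose al := chord_slope p (1 - M) (1 - m); pose be := chord_offset p (1 - M) (1 - m).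
have al0 : 0 < al by exact: chord_slope_gt0.
apply: op_le_trans (op_powR_le_affine p0 p1 a0 b1 aS Sb al0) _.
(* Cancelling the intercept of the tangent, then - be, leaves the chord at S to be compared with the
   weighted sum of powers. *)
rewrite deltaE -/al -/be rmorphB scalerBl addrC -addrA.
apply: op_leD; first by rewrite /op_le subrr => x; rewrite inner0l.
rewrite -[al%:C *: S](addKr (be%:C *: \Id_K)).
apply: op_leD; first by rewrite /op_le subrr => x; rewrite inner0l.
rewrite addrC.
(* Unital maps and weights of sum 1 preserve affine functions, so the chord bound can be applied
   under each [Phi j]. *)
have -> : al%:C *: S + be%:C *: \Id_K = \sum_(j < n) (w j)%:C *:
    Phi j (al%:C *: (\Id_H - A j) + be%:C *: \Id_H).
  rewrite -[X in _ + X](sum_weights _ w1) scaler_sumr -big_split.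
  apply: eq_bigr => j _ /=.
  rewrite (linearD (Phi j) (al%:C *: _)) (linearZ _ (\Id_H - A j)) /= unital_map_scal//.
  by rewrite scalerDr !scalerA mulrC.
apply: op_le_sum => j; apply: op_leZ => //; apply: positive_map_le => //.
exact: chord_le_op_powR.
Qed.

End PositiveMaps.

Theorem corollary2p8 (R : realType) (H K : hilbertType R) (m M p : R)
    (n : nat) (A : 'I_n -> bop H) (Phi : 'I_n -> {linear bop H -> bop K})
    (w : 'I_n -> R) :
  0 <= m -> m < M -> M < 1 ->
  (forall j, selfadjoint (A j)) ->
  (forall j, op_contraction (A j)) ->
  (forall j, op_le (m%:C *: \Id_H) (A j) /\ op_le (A j) (M%:C *: \Id_H)) ->
  (forall j, positive_map (Phi j)) ->
  (forall j, unital_map (Phi j)) ->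
  (forall j, 0 < w j) ->
  \sum_(j < n) w j = 1 ->
  0 < p -> p < 1 ->
  op_le
    (op_powR (\sum_(j < n) (w j)%:C *: Phi j (\Id_H - A j)) p)
    ((delta m M p)%:C *: \Id_K +
       \sum_(j < n) (w j)%:C *: Phi j (op_powR (\Id_H - A j) p))
  /\
  forall Psi : {linear bop H -> bop K},
    positive_map Psi -> unital_map Psi ->
    op_le
      (op_powR (Psi (\sum_(j < n) (w j)%:C *: (\Id_H - A j))) p)
      ((delta m M p)%:C *: \Id_K +
         Psi (\sum_(j < n) (w j)%:C *: op_powR (\Id_H - A j) p)).
Proof.
move=> m0 mM M1 _ _ Abd Phi_ge0 Phi1 w0 w1 p0 p1.
split=> [|Psi Psi0 Psi1]; first exact: sum_positive_map_powR.
(* By linearity the second inequality is the first for the constant family [Psi]. *)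
have Psi_sum (F : 'I_n -> bop H) : Psi (\sum_(j < n) (w j)%:C *: F j) =
    \sum_(j < n) (w j)%:C *: Psi (F j).
  by rewrite linear_sum; apply: eq_bigr => j _; rewrite linearZ.
rewrite !Psi_sum.
exact: (@sum_positive_map_powR _ _ _ m M p n A (fun=> Psi)).
Qed.
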